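(* Let $n$ and $m$ be relatively prime integers, both bigger than $1$, and assume that $n$ is relatively prime to $\phi(m)$, where $\phi$ is Euler's totient function. Then there is no cyclic extension $K/\mathbb{Q}$ of degree $n$ whose ideal class group is cyclic of order $m$. *)

(* Defs.v *)
From HB Require Import structures.
From mathcomp Require Import all_boot all_algebra all_field.
From mathcomp Require Import boolp classical_sets.

Set Implicit Arguments.
Unset Strict Implicit.
Unset Printing Implicit Defensive.

Import GRing.Theory.
Local Open Scope ring_scope.
Local Open Scope classical_set_scope.
Local Open Scope quotient_scope.

Section IdealClassGroup.
Variable K : fieldExtType rat.
Implicit Types I J L : set K.

Definition ring_of_integers : set K :=
  [set x | integralOver (intr : int -> K) x].
Local Notation O := ring_of_integers.

Definition is_frac_ideal I : Prop :=
  [/\ I 0,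
      forall x y, I x -> I y -> I (x + y),
      forall a x, O a -> I x -> I (a * x),
      exists2 x, I x & x != 0
    & exists2 d, O d /\ d != 0 & forall x, I x -> O (d * x)].

Record frac_ideal := FracIdeal {
  frac_ideal_set :> set K;
  frac_idealP : is_frac_ideal frac_ideal_set }.

Definition mul_ideal I J : set K :=
  [set x | exists2 s : seq (K * K),
     forall p, p \in s -> I p.1 /\ J p.2 & x = \sum_(p <- s) p.1 * p.2].

(* Since 0 is excluded, c ranges over K^* and [scale_ideal c O] over the
   principal fractional ideals. *)
Definition scale_ideal (c : K) I : set K := [set c * x | x in I].

Definition ideal_equiv (I J : frac_ideal) : Prop :=
  exists2 c : K, c != 0 & frac_ideal_set J = scale_ideal c I.

Lemma frac_ideal_inj (I J : frac_ideal) : (I : set K) = J -> I = J.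
Proof.
case: I J => [I hI] [J hJ] /= eIJ; case: J / eIJ hJ => hJ.
by congr FracIdeal; apply: Prop_irrelevance.
Qed.

Lemma O1 : O 1. Proof. exact: integral1. Qed.

Lemma OM a b : O a -> O b -> O (a * b). Proof. exact: integral_mul. Qed.

Lemma frac_ideal_O : is_frac_ideal O.
Proof.
split.
- exact: integral0.
- exact: integral_add.
- exact: OM.
- by exists 1; [exact: O1 | exact: oner_neq0].
by exists 1 => [|x Ox]; [split; [exact: O1 | exact: oner_neq0] | rewrite mul1r].
Qed.

Lemma mul_ideal_min I J L :
  L 0 -> (forall x y, L x -> L y -> L (x + y)) ->
  (forall x y, I x -> J y -> L (x * y)) -> mul_ideal I J `<=` L.
Proof.
move=> L0 LD LM _ [s hs ->]; rewrite big_seq.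
by apply: (big_ind L) => // p /hs[]; apply: LM.
Qed.

Lemma mul_ideal0 I J : mul_ideal I J 0.
Proof. by exists [::] => //; rewrite big_nil. Qed.

Lemma mul_idealD I J x y :
  mul_ideal I J x -> mul_ideal I J y -> mul_ideal I J (x + y).
Proof.
move=> [s hs ->] [t ht ->]; exists (s ++ t); last by rewrite big_cat.
by move=> p; rewrite mem_cat => /orP[/hs|/ht].
Qed.

Lemma mul_idealM I J x y : I x -> J y -> mul_ideal I J (x * y).
Proof.
move=> Ix Jy; exists [:: (x, y)]; last by rewrite big_seq1.
by move=> p; rewrite inE => /eqP->.
Qed.

Lemma mul_idealC I J : mul_ideal I J = mul_ideal J I.
Proof.
by apply/seteqP; split; apply: mul_ideal_min;
  [exact: mul_ideal0 | exact: mul_idealD |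
   move=> x y ? ?; rewrite mulrC; exact: mul_idealM
  |exact: mul_ideal0 | exact: mul_idealD |
   move=> x y ? ?; rewrite mulrC; exact: mul_idealM].
Qed.

Lemma mul_ideal_sub_assoc I J L :
  mul_ideal I (mul_ideal J L) `<=` mul_ideal (mul_ideal I J) L.
Proof.
apply: mul_ideal_min; [exact: mul_ideal0 | exact: mul_idealD |].
move=> x y Ix.
apply: (@mul_ideal_min J L [set y | mul_ideal (mul_ideal I J) L (x * y)]) => /=.
- by rewrite mulr0; apply: mul_ideal0.
- by move=> u v hu hv; rewrite mulrDr; apply: mul_idealD.
by move=> u v Ju Lv; rewrite mulrA; do 2?apply: mul_idealM.
Qed.

Lemma mul_idealA I J L :
  mul_ideal I (mul_ideal J L) = mul_ideal (mul_ideal I J) L.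
Proof.
apply/seteqP; split; first exact: mul_ideal_sub_assoc.
rewrite mul_idealC (mul_idealC I J) (mul_idealC I (mul_ideal J L)).
by rewrite (mul_idealC J L); apply: mul_ideal_sub_assoc.
Qed.

Lemma frac_ideal_mul (I J : frac_ideal) : is_frac_ideal (mul_ideal I J).
Proof.
case: I J => [I [I0 ID IM [x Ix x0] [d [Od d0] hd]]].
case=> [J [J0 JD JM [y Jy y0] [e [Oe e0] he]]] /=; split.
- exact: mul_ideal0.
- exact: mul_idealD.
- move=> a z Oa.
  apply: (@mul_ideal_min I J [set z | mul_ideal I J (a * z)]) => /=.
  + by rewrite mulr0; apply: mul_ideal0.
  + by move=> u v hu hv; rewrite mulrDr; apply: mul_idealD.
  + by move=> u v Iu Jv; rewrite mulrA; apply: mul_idealM => //; apply: IM.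
- by exists (x * y); [exact: mul_idealM | rewrite mulf_neq0].
exists (d * e); first by split; [exact: OM | rewrite mulf_neq0].
move=> z; apply: (@mul_ideal_min I J [set z | O (d * e * z)]) => /=.
- by rewrite mulr0; apply: integral0.
- by move=> u v hu hv; rewrite mulrDr; apply: integral_add.
by move=> u v Iu Jv; rewrite mulrACA; apply: OM; [apply: hd | apply: he].
Qed.

Lemma mul_ideal_O (I : frac_ideal) : mul_ideal O I = I.
Proof.
case: I => [I [I0 ID IM _ _]] /=; apply/seteqP; split; first exact: mul_ideal_min.
by move=> x Ix; rewrite -[x]mul1r; apply: mul_idealM => //; apply: O1.
Qed.

Lemma mul_scale_ideal c I J :
  mul_ideal (scale_ideal c I) J = scale_ideal c (mul_ideal I J).
Proof.
apply/seteqP; split.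
  apply: mul_ideal_min.
  - by exists 0; [exact: mul_ideal0 | rewrite mulr0].
  - by move=> _ _ [x hx <-] [y hy <-]; exists (x + y);
      [exact: mul_idealD | rewrite mulrDr].
  by move=> _ y [x Ix <-] Jy; exists (x * y); [exact: mul_idealM | rewrite mulrA].
move=> _ [x hx <-]; move: x hx.
apply: (@mul_ideal_min I J [set x | mul_ideal (scale_ideal c I) J (c * x)]) => /=.
- by rewrite mulr0; apply: mul_ideal0.
- by move=> u v hu hv; rewrite mulrDr; apply: mul_idealD.
by move=> u v Iu Jv; rewrite mulrA; apply: mul_idealM => //; exists u.
Qed.

Lemma scale_idealA c d I : scale_ideal c (scale_ideal d I) = scale_ideal (c * d) I.
Proof.
apply/seteqP; split; first by move=> _ [_ [x Ix <-] <-]; exists x; rewrite ?mulrA.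
by move=> _ [x Ix <-]; exists (d * x); rewrite ?mulrA //; exists x.
Qed.

Lemma scale_ideal1 I : scale_ideal 1 I = I.
Proof.
apply/seteqP; split; first by move=> _ [x Ix <-]; rewrite mul1r.
by move=> x Ix; exists x; rewrite ?mul1r.
Qed.

HB.instance Definition _ := gen_eqMixin frac_ideal.
HB.instance Definition _ := gen_choiceMixin frac_ideal.

Definition ideal_equivb (I J : frac_ideal) : bool := `[< ideal_equiv I J >].

Lemma ideal_equiv_refl : reflexive ideal_equivb.
Proof. by move=> I; apply/asboolP; exists 1; rewrite ?oner_neq0 ?scale_ideal1. Qed.

Lemma ideal_equiv_imp_sym (I J : frac_ideal) : ideal_equivb I J -> ideal_equivb J I.
Proof.
move=> /asboolP[c c0 hJ]; apply/asboolP; exists c^-1; first by rewrite invr_neq0.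
by rewrite hJ scale_idealA mulVf // scale_ideal1.
Qed.

Lemma ideal_equiv_sym : symmetric ideal_equivb.
Proof. by move=> I J; apply/idP/idP; apply: ideal_equiv_imp_sym. Qed.

Lemma ideal_equiv_trans : transitive ideal_equivb.
Proof.
move=> J I L /asboolP[c c0 hJ] /asboolP[d d0 hL]; apply/asboolP.
by exists (d * c); [rewrite mulf_neq0 | rewrite hL hJ scale_idealA].
Qed.

Canonical ideal_equiv_rel :=
  EquivRel ideal_equivb ideal_equiv_refl ideal_equiv_sym ideal_equiv_trans.

(* Only the monoid structure (product of ideals, unit the class of O_K) is
   declared below: that this monoid is a group is the invertibility of nonzero
   ideals in the Dedekind domain O_K, which is not needed to define it. *)
Definition ideal_class_group : Type := {eq_quot ideal_equiv_rel}.
Local Notation Cl := ideal_class_group.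

HB.instance Definition _ := EqQuotient.on ideal_class_group.
HB.instance Definition _ := Choice.on ideal_class_group.

Definition frac_ideal_one : frac_ideal := FracIdeal frac_ideal_O.
Definition frac_ideal_prod (I J : frac_ideal) : frac_ideal :=
  FracIdeal (frac_ideal_mul I J).

Definition class_one : Cl := \pi_Cl frac_ideal_one.
Definition class_mul (x y : Cl) : Cl :=
  \pi_Cl (frac_ideal_prod (repr x) (repr y)).

Lemma pi_class_mul (I J : frac_ideal) :
  class_mul (\pi_Cl I) (\pi_Cl J) = \pi_Cl (frac_ideal_prod I J).
Proof.
apply/eqmodP/asboolP.
have /eqmodP/asboolP[c c0 hI] := reprK (\pi_Cl I).
have /eqmodP/asboolP[d d0 hJ] := reprK (\pi_Cl J).
exists (c * d); first by rewrite mulf_neq0.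
rewrite /= hI hJ mul_scale_ideal mul_idealC mul_scale_ideal scale_idealA.
by rewrite mul_idealC.
Qed.

Lemma class_mulC : commutative class_mul.
Proof.
elim/quotW=> I; elim/quotW=> J; rewrite !pi_class_mul; congr (\pi_Cl _).
by apply: frac_ideal_inj; apply: mul_idealC.
Qed.

Lemma class_mulA : associative class_mul.
Proof.
elim/quotW=> I; elim/quotW=> J; elim/quotW=> L.
rewrite (pi_class_mul J L) (pi_class_mul I J) !pi_class_mul.
by congr (\pi_Cl _); apply: frac_ideal_inj; apply: mul_idealA.
Qed.

Lemma class_mul1 : left_id class_one class_mul.
Proof.
elim/quotW=> I; rewrite pi_class_mul; congr (\pi_Cl _).
by apply: frac_ideal_inj; apply: mul_ideal_O.
Qed.

Lemma class_mul1r : right_id class_one class_mul.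
Proof. by move=> x; rewrite class_mulC class_mul1. Qed.

HB.instance Definition _ :=
  isMonoid.Build ideal_class_group class_mulA class_mul1 class_mul1r.

End IdealClassGroup.

(* [G] is a cyclic group of order m: 1, g, ..., g ^+ (m - 1) lists the elements
   of G without repetition and g ^+ m = 1.  In particular every element of G is
   invertible, so that the definition makes sense for a monoid. *)
Definition cyclic_group_of_order (G : monoidType) (m : nat) : Prop :=
  exists2 g : G, (g ^+ m)%g = 1%g &
    forall x : G, exists! i : 'I_m, x = (g ^+ i)%g.

(* Main.v *)
(** The Galois group G acts on the class group Cl = <g> of order m through
    (Z/m)^*, of order phi(m) prime to n = |G|; hence it acts trivially.  The class
    of the norm N(J) = prod_s s(J) of an ideal J in g is therefore g^n.  But N(J) is
    principal, generated by a rational number, so g^n = 1, and with g^m = 1 this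
    gives g = 1.  Invertibility of ideals is not proved: it comes from the assumption
    that Cl is a group. *)
Require Import Defs.
From mathcomp Require Import all_boot all_order all_fingroup all_algebra all_solvable all_field.
From mathcomp Require Import boolp classical_sets.

Set Implicit Arguments.
Unset Strict Implicit.
Unset Printing Implicit Defensive.

Import GRing.Theory.
Local Open Scope ring_scope.
Local Open Scope classical_set_scope.
Local Open Scope quotient_scope.

(** * Prime ideals of the ring of integers, and Gauss' lemma modulo a prime *)

Section PrimeIdeals.
Variable K : fieldExtType rat.
Local Notation O := (@ring_of_integers K).
Implicit Types (A D P : set K) (f g : {poly K}).

Definition submodule A : Prop :=
  [/\ A 0, forall x y, A x -> A y -> A (x + y) &
      forall a x, O a -> A x -> A (a * x)].

Lemma submodule_frac_ideal (I : frac_ideal K) : submodule I.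
Proof. by case: I => I []. Qed.

Lemma submodule_scale c A : submodule A -> submodule (scale_ideal c A).
Proof.
move=> [A0 AD AM]; split.
- by exists 0; rewrite ?mulr0.
- by move=> _ _ [x Ax <-] [y Ay <-]; exists (x + y); rewrite ?mulrDr //; exact: AD.
by move=> a _ Oa [x Ax <-]; exists (a * x); rewrite 1?mulrCA //; exact: AM.
Qed.

Lemma submodule_opp A x : submodule A -> A x -> A (- x).
Proof.
case=> _ _ AM Ax; rewrite -mulN1r; apply: AM => //.
exact/integral_opp/integral1.
Qed.

Lemma submodule_sum A (T : Type) (r : seq T) (p : pred T) (F : T -> K) :
  submodule A -> (forall i, p i -> A (F i)) -> A (\sum_(i <- r | p i) F i).
Proof. by case=> A0 AD _ AF; apply: (big_ind A). Qed.

Lemma O_int (z : int) : O z%:~R.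
Proof. exact: integral_id. Qed.

Lemma submodule_O : submodule O.
Proof. exact: (submodule_frac_ideal (@frac_ideal_one K)). Qed.

Definition prime_ideal P : Prop :=
  [/\ submodule P, P `<=` O, ~ P 1 &
      forall a b, O a -> O b -> P (a * b) -> P a \/ P b].

(** An ideal that is maximal among the proper ones containing [D] is prime: if it misses [a],
    adjoining [a] yields 1 = p + r a, and then b = b p + r (a b) lies in it as soon as a b does. *)
Lemma prime_ideal_exists D :
  submodule D -> D `<=` O -> ~ D 1 -> exists2 P, prime_ideal P & D `<=` P.
Proof.
move=> sD DO D1.
(* Adjoining D inside the predicate makes the empty chain harmless. *)
pose proper A := [/\ submodule (A `|` D), A `<=` O & ~ (A `|` D) 1].
have chain (F : set (set K)) : F `<=` proper -> total_on F subset ->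
    proper (\bigcup_(X in F) X).
  move=> Fp Ft; have [D0 DD DM] := sD; split.
  - split; first by right.
    + have inU X z : F X -> (X `|` D) z -> (\bigcup_(X in F) X `|` D) z.
        by move=> FX [Xz|]; [left; exists X | right].
      move=> x y [[X FX Xx]|Dx] [[Y FY Yy]|Dy]; last by right; exact: DD.
      * have [XY|YX] := Ft _ _ FX FY.
          have [[_ h _] _ _] := Fp _ FY; apply: (inU Y) => //.
          by apply: h; left => //; exact: XY.
        have [[_ h _] _ _] := Fp _ FX; apply: (inU X) => //.
        by apply: h; left => //; exact: YX.
      * by have [[_ h _] _ _] := Fp _ FX; apply: (inU X) => //; apply: h; [left|right].
      by have [[_ h _] _ _] := Fp _ FY; apply: (inU Y) => //; apply: h; [right|left].
    move=> a x Oa [[X FX Xx]|Dx]; last by right; exact: DM.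
    have [[_ _ h] _ _] := Fp _ FX.
    by have [|] := h a x Oa (or_introl Xx); [left; exists X | right].
  - by move=> x [X FX Xx]; have [_ + _] := Fp _ FX; apply.
  by case=> // -[X FX X1]; have [_ _ []] := Fp _ FX; left.
have [A [[sA AO A1] Amax]] := Zorn_bigcup chain.
exists (A `|` D); last by move=> x; right.
split=> //; first by move=> x [/AO|/DO].
have [P0 PD PM] := sA.
move=> a b Oa Ob Pab; apply: contrapT => /not_orP[nPa nPb].
pose B := [set z | exists2 p, (A `|` D) p & exists2 r, O r & z = p + r * a].
have OM := @OM K.
have subB : A `|` D `<=` B.
  move=> x Px; exists x => //; exists 0; first exact: integral0.
  by rewrite mul0r addr0.
have BD : B `|` D = B by apply/setUidPl => x Dx; apply: subB; right.
apply: (Amax B).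
  split; first by move=> x Ax; apply: subB; left.
  move=> BA; apply: nPa; left; apply: BA; exists 0 => //.
  by exists 1; [exact: O1 | rewrite mul1r add0r].
rewrite /proper BD; split.
- split; first by apply: subB.
  + move=> _ _ [p Pp [r Or ->]] [q Pq [s Os ->]]; exists (p + q); first exact: PD.
    by exists (r + s); [exact: integral_add | rewrite mulrDl addrACA].
  move=> c _ Oc [p Pp [r Or ->]]; exists (c * p); first exact: PM.
  by exists (c * r); [exact: OM | rewrite mulrDr mulrA].
- move=> _ [p Pp [r Or ->]]; apply: integral_add; last exact: OM.
  by case: Pp => [/AO|/DO].
move=> [p Pp [r Or e1]]; apply: nPb; rewrite -[b]mulr1 e1 mulrDr mulrCA.
by apply: PD; [exact: PM | rewrite (mulrC b); exact: PM].
Qed.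

(** Gauss' lemma modulo [P]: if i and j are the least indices of coefficients of [f] and [g] outside
    [P], the coefficient of index i + j in [f * g] is f_i g_j plus terms in [P]. *)
Lemma coef_mul_notin P f g :
  prime_ideal P -> (forall i, O f`_i) -> (forall i, O g`_i) ->
  (exists i, ~ P f`_i) -> (exists i, ~ P g`_i) -> exists i, ~ P (f * g)`_i.
Proof.
move=> [sP PO P1 Pprime] Of Og nPf nPg.
have least (h : {poly K}) : (exists i, ~ P h`_i) ->
    exists2 i, ~ P h`_i & forall j, (j < i)%N -> P h`_j.
  move=> hP; have hb : exists i, `[< ~ P h`_i >] by case: hP => i /asboolP; exists i.
  case: (ex_minnP hb) => i /asboolP ni mi; exists i => // j ji.
  by apply: contrapT => /asboolP/mi; rewrite leqNgt ji.
have [i nPi Pi] := least f nPf; have [j nPj Pj] := least g nPg.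
exists (i + j)%N => Pk.
have ik : (i < (i + j).+1)%N by rewrite ltnS leq_addr.
suff : P (f`_i * g`_j) by case/(Pprime _ _ (Of i) (Og j)).
have [_ PD PM] := sP.
move: Pk; rewrite coefM (bigD1 (Ordinal ik)) //= addKn.
(* Each term of [R] involves either a coefficient of [f] of index below i or one of [g] of index
   below j. *)
set R := \sum_(_ < _ | _) _ => Pk; rewrite -[_ * _](addrK R).
apply: PD => //; apply: submodule_opp => //; apply: submodule_sum => //= l.
rewrite -val_eqE /= neq_ltn => /orP[li|il].
  by rewrite mulrC; apply: PM; [exact: Og | exact: Pi].
apply: PM; first exact: Of.
by apply: Pj; rewrite ltn_subLR ?ltn_add2r // -ltnS ltn_ord.
Qed.

End PrimeIdeals.

(** * Finite products of fractional ideals *)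

Section IdealProducts.
Variables (K : fieldExtType rat) (T : Type).
Local Notation O := (@ring_of_integers K).
Implicit Types (I J : T -> frac_ideal K) (r : seq T).

(** With [r] the list of the Galois group and [J] the conjugates of an ideal, this is the norm of
    that ideal, kept as an ideal of [K]. *)
Definition ideal_prod r J : frac_ideal K :=
  foldr (fun t L => frac_ideal_prod (J t) L) (@frac_ideal_one K) r.

Lemma prod_mem r J (x : T -> K) :
  (forall t, frac_ideal_set (J t) (x t)) ->
  frac_ideal_set (ideal_prod r J) (\prod_(t <- r) x t).
Proof.
move=> Jx; elim: r => [|t r IH] /=; first by rewrite big_nil; exact: O1.
by rewrite big_cons; exact: mul_idealM.
Qed.

Lemma coef_prod_mem r J (f : T -> {poly K}) :
  (forall t i, frac_ideal_set (J t) (f t)`_i) ->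
  forall i, frac_ideal_set (ideal_prod r J) (\prod_(t <- r) f t)`_i.
Proof.
move=> Jf; elim: r => [|t r IH] i /=.
  by rewrite big_nil coef1; case: (i == 0)%N; [exact: O1 | exact: integral0].
rewrite big_cons coefM.
apply: (@submodule_sum K) => [|j _]; last exact: mul_idealM.
exact: (submodule_frac_ideal (frac_ideal_prod (J t) _)).
Qed.

Lemma ideal_prod_pairing r I J :
  (forall t, mul_ideal (I t) (J t) `<=` O) ->
  mul_ideal (ideal_prod r I) (ideal_prod r J) `<=` O.
Proof.
move=> IJ; elim: r => [|t r IH] /=;
  first by apply: mul_ideal_min; [exact: integral0 | exact: integral_add | exact: OM].
apply: mul_ideal_min; [exact: integral0 | exact: integral_add | move=> x y Ix Jy].
pose L1 := [set x | O (x * y)]; apply: (mul_ideal_min (L := L1)) Ix; rewrite /L1 /=.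
- by rewrite mul0r; exact: integral0.
- by move=> u v ? ?; rewrite mulrDl; exact: integral_add.
move=> u v Iu Iv.
pose L2 := [set y | O (u * v * y)]; apply: (mul_ideal_min (L := L2)) Jy; rewrite /L2 /=.
- by rewrite mulr0; exact: integral0.
- by move=> ? ? ? ?; rewrite mulrDr; exact: integral_add.
move=> w z Jw Jz; rewrite mulrACA; apply: OM.
  by apply: (IJ t); exact: mul_idealM.
by apply: IH; exact: mul_idealM.
Qed.

Lemma prod_coef_notin P r (f : T -> {poly K}) :
  prime_ideal P -> (forall t i, O (f t)`_i) -> (forall t, exists i, ~ P (f t)`_i) ->
  exists i, ~ P (\prod_(t <- r) f t)`_i.
Proof.
move=> Pp Of nPf.
(* Integrality of the partial products joins the induction, since [coef_mul_notin] asks for it in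
   both factors. *)
suff [] : (forall i, O (\prod_(t <- r) f t)`_i) /\
  exists i, ~ P (\prod_(t <- r) f t)`_i by [].
elim: r => [|t r [Or nPr]].
  rewrite big_nil; split; last by exists 0; rewrite coef1; case: Pp.
  by move=> i; rewrite coef1; exact: (O_int K (i == 0)%N).
rewrite big_cons; split; last exact: coef_mul_notin.
by move=> i; rewrite coefM; apply: submodule_sum (submodule_O K) _ => j _; exact: OM.
Qed.

End IdealProducts.

(** * Content of a polynomial with rational coefficients *)

Section Content.

(** By Bezout a gcd of two elements is an integral combination of them, and passing to absolute
    values only multiplies by a sign. *)
Lemma gcdn_closed (A : int -> Prop) (T : Type) (r : seq T) (F : T -> int) :
  A 0 -> (forall x y, A x -> A y -> A (x + y)) -> (forall a x, A x -> A (a * x)) ->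
  (forall i, A (F i)) -> A (Posz (\big[gcdn/0%N]_(i <- r) `|F i|%N)).
Proof.
move=> A0 AD AM AF; elim/big_ind: _ => // [x y Ax Ay|i _]; last first.
  by rewrite abszEsign; apply: AM.
have [u [v]] := Bezoutz x y.
by rewrite /gcdz !absz_nat => <-; apply: AD; apply: AM.
Qed.

(** Here [c] is the content of [p], up to sign. The last clause expresses the primitivity of [q]
    through ideals: the content is an integral combination of the coefficients of [p]. *)
Lemma rational_content (K : fieldExtType rat) (p : {poly K}) :
  p != 0 -> (forall i, p`_i \in 1%VS) ->
  exists c, exists q : {poly int},
    [/\ c != 0, p = c *: map_poly intr q &
        forall A : set K, submodule A -> (forall i, A p`_i) -> A c].
Proof.
move=> p0 pQ.
have [pr pE] : exists pr : {poly rat}, p = map_poly (in_alg K) pr.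
  have /choice [h hE] : forall i, exists k : rat, p`_i = k%:A.
    by move=> i; have /vlineP := pQ i.
  exists (\poly_(i < size p) h i); apply/polyP => i.
  rewrite coef_map coef_poly; case: ltnP => [_|/leq_sizeP/(_ i (leqnn _))->] /=.
    exact: hE.
  by rewrite scale0r.
have [q [a a0 prE]] := rat_poly_scale pr.
have pE' : p = (a%:~R)^-1 *: map_poly intr q.
  rewrite pE prE; apply/polyP => i; rewrite !(coef_map, coefZ) /=.
  by rewrite -[LHS]/(in_alg K _) rmorphM fmorphV !rmorph_int.
have q0 : q != 0 by apply: contra_neq p0 => q0; rewrite pE' q0 rmorph0 scaler0.
have aK : (a%:~R : K) != 0.
  by rewrite -(rmorph_int (in_alg K)) fmorph_eq0 intr_eq0.
(* Since [p] is [q] divided by [a], its content is that of [q] divided by [a]. *)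
exists ((a%:~R)^-1 * (zcontents q)%:~R), (zprimitive q); split.
- rewrite mulf_neq0 ?invr_eq0 // -(rmorph_int (in_alg K)) fmorph_eq0 intr_eq0.
  by rewrite zcontents_eq0.
- rewrite pE' {1}(zpolyEprim q); apply/polyP => i.
  by rewrite !(coefZ, coef_map) /= rmorphM mulrA.
move=> A [A0 AD AM] Ap.
pose B (z : int) := A ((a%:~R)^-1 * z%:~R).
have BM x y : B y -> B (x * y).
  by move=> By; rewrite /B rmorphM /= mulrCA; apply: AM; rewrite //; exact: O_int.
(* [zcontents q] is the gcd of the coefficients with the sign of the leading one; [B] is an ideal of
   Z containing these coefficients. *)
apply: (BM (sgz (lead_coef q))); apply: gcdn_closed => //.
- by rewrite /B mulr0.
- by move=> x y Bx By; rewrite /B rmorphD mulrDr; exact: AD.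
by move=> i; move: (Ap i); rewrite pE' coefZ coef_map.
Qed.

End Content.

(** * Galois action on ideals and classes, and principality of norms *)

Section GaloisAction.
Variable K : splittingFieldType rat.
Local Notation O := (@ring_of_integers K).
Local Notation G := (gal_of {:K}).
Local Notation Cl := (ideal_class_group K).
Implicit Types (s t : G) (A : set K) (I J : frac_ideal K).

(** Products in [gal_of] compose from left to right, so the actions on ideals and classes are right
    actions. *)
Lemma galMT s t x : (s * t)%g x = t (s x).
Proof. by rewrite galM ?memvf. Qed.

Lemma gal_can_inv s : cancel (s^-1)%g s.
Proof. by move=> x; rewrite -galMT mulVg gal_id. Qed.

Lemma O_gal s x : O x -> O (s x).
Proof.
move/(integral_rmorph s); congr (integralOver _ _).
by apply/funext => z /=; rewrite rmorph_int.
Qed.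

Lemma gal_is_frac_ideal s I : is_frac_ideal (s @` I).
Proof.
case: I => I [I0 ID IM [x Ix x0] [d [Od d0] Id]] /=; split.
- by exists 0; rewrite ?rmorph0.
- by move=> _ _ [y Iy <-] [z Iz <-]; exists (y + z); rewrite ?rmorphD //; exact: ID.
- move=> a _ Oa [y Iy <-]; exists ((s^-1)%g a * y); last first.
    by rewrite rmorphM /= gal_can_inv.
  by apply: IM => //; exact: O_gal.
- by exists (s x); [exists x | rewrite fmorph_eq0].
exists (s d); first by split; [exact: O_gal | rewrite fmorph_eq0].
by move=> _ [y Iy <-]; rewrite -rmorphM; apply: O_gal; exact: Id.
Qed.

Definition gal_ideal s I : frac_ideal K := FracIdeal (gal_is_frac_ideal s I).

Lemma gal_ideal_mem s I x :
  frac_ideal_set I x -> frac_ideal_set (gal_ideal s I) (s x).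
Proof. by exists x. Qed.

Lemma gal_ideal1 I : gal_ideal 1%g I = I.
Proof.
apply: frac_ideal_inj; rewrite /= (@eq_imagel _ _ _ _ id) ?image_id // => x _.
exact: gal_id.
Qed.

Lemma gal_idealM s t I : gal_ideal (s * t)%g I = gal_ideal t (gal_ideal s I).
Proof.
apply: frac_ideal_inj; rewrite /= image_comp.
by apply: eq_imagel => x _; exact: galMT.
Qed.

Lemma gal_mul_ideal s I J : s @` mul_ideal I J = mul_ideal (s @` I) (s @` J).
Proof.
apply/seteqP; split.
  apply/image_subP; apply: mul_ideal_min => /=.
  - by rewrite rmorph0; exact: mul_ideal0.
  - by move=> u v ? ?; rewrite rmorphD; exact: mul_idealD.
  by move=> u v Iu Jv; rewrite rmorphM; apply: mul_idealM; [exists u | exists v].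
apply: mul_ideal_min.
- by exists 0; [exact: mul_ideal0 | rewrite rmorph0].
- move=> _ _ [u Iu <-] [v Iv <-].
  by exists (u + v); [exact: mul_idealD | rewrite rmorphD].
move=> _ _ [u Iu <-] [v Iv <-].
by exists (u * v); [exact: mul_idealM | rewrite rmorphM].
Qed.

Lemma gal_ideal_prod s I J :
  gal_ideal s (frac_ideal_prod I J) = frac_ideal_prod (gal_ideal s I) (gal_ideal s J).
Proof. by apply: frac_ideal_inj; exact: gal_mul_ideal. Qed.

Lemma gal_ideal_one s : gal_ideal s (frac_ideal_one K) = frac_ideal_one K.
Proof.
apply: frac_ideal_inj; apply/seteqP; split => /=.
  by move=> _ [x Ox <-]; exact: O_gal.
by move=> x Ox; exists ((s^-1)%g x); [exact: O_gal | exact: gal_can_inv].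
Qed.

Definition gal_class s (x : Cl) : Cl := \pi_Cl (gal_ideal s (generic_quotient.repr x)).

(** The choice of representative is harmless because s(c I) = s(c) s(I). *)
Lemma pi_gal_class s I : gal_class s (\pi_Cl I) = \pi_Cl (gal_ideal s I).
Proof.
apply/eqmodP/asboolP; have /eqmodP/asboolP[c c0 hI] := reprK (\pi_Cl I).
exists (s c); first by rewrite fmorph_eq0.
rewrite /= hI; apply/seteqP; split.
  move=> _ [_ [y Iy <-] <-]; exists (s y); last by rewrite rmorphM.
  by exists y.
move=> _ [_ [y Iy <-] <-]; exists (c * y); last by rewrite rmorphM.
by exists y.
Qed.

Lemma gal_class1 x : gal_class 1%g x = x.
Proof. by elim/quotW: x => I; rewrite pi_gal_class gal_ideal1. Qed.

Lemma gal_classM s t x : gal_class (s * t)%g x = gal_class t (gal_class s x).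
Proof. by elim/quotW: x => I; rewrite (pi_gal_class s) !pi_gal_class gal_idealM. Qed.

Lemma gal_class_one s : gal_class s (1%g : Cl) = 1%g.
Proof. by rewrite [LHS](pi_gal_class s (frac_ideal_one K)) gal_ideal_one. Qed.

Lemma gal_class_mul s (x y : Cl) :
  gal_class s (x * y)%g = (gal_class s x * gal_class s y)%g.
Proof.
elim/quotW: x => I; elim/quotW: y => J.
rewrite [(_ * _)%g]pi_class_mul !pi_gal_class gal_ideal_prod.
by rewrite [RHS]pi_class_mul.
Qed.

Lemma gal_class_exp s (x : Cl) i : gal_class s (x ^+ i)%g = (gal_class s x ^+ i)%g.
Proof.
by elim: i => [|i IH]; rewrite ?expg0 ?gal_class_one // !expgS gal_class_mul IH.
Qed.

(* Gauss' lemma in place of factorization into primes: with 1 = sum_k a_k b_k,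
   a_k in I and b_k in J, the conjugates of f = sum_k a_k X^k multiply to c q with
   q primitive in Z[X].  Then c * N(J) lies in O, and no prime P contains it: for
   each s some conjugate s(b_k) takes s(f) into O[X] but not into P[X]. *)
Lemma norm_ideal_principal I J :
  galois 1 {:K} -> mul_ideal I J = O ->
  exists2 c, c != 0 &
    frac_ideal_set (ideal_prod (enum {: G}) (gal_ideal^~ J)) = scale_ideal c O.
Proof.
move=> galK IJ.
have : mul_ideal I J 1 by rewrite IJ; exact: O1.
case=> r rIJ e1.
have rI k : frac_ideal_set I (nth (0, 0) r k).1.
  have [/(mem_nth (0, 0))/rIJ[]//|/(nth_default (0, 0))->] := ltnP k (size r).
  by case: (submodule_frac_ideal I).
pose f := \poly_(k < size r) (nth (0, 0) r k).1.
have fI k : frac_ideal_set I f`_k.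
  by rewrite coef_poly; case: ifP => // _; case: (submodule_frac_ideal I).
pose F := \prod_(s <- enum {: G}) map_poly s f.
have f0 : f != 0.
  apply/eqP => f0; move/eqP: e1; rewrite (big_nth (0, 0)) big_mkord big1 ?oner_eq0 // => k _.
  have := congr1 (fun p : {poly K} => p`_k) f0; rewrite coef_poly ltn_ord coef0 => ->.
  by rewrite mul0r.
have F0 : F != 0.
  by rewrite prodf_seq_neq0; apply/allP => s _; rewrite map_poly_eq0.
(* Each [t] permutes the factors of [F], so the coefficients are fixed by the Galois group and hence
   rational. *)
have FQ i : F`_i \in 1%VS.
  have /galois_fixedField <- := galK.
  apply/fixedFieldP; first exact: memvf.
  move=> t _; rewrite -coef_map; suff -> : map_poly t F = F by [].
  rewrite /F rmorph_prod /= !big_enum /= [RHS](reindex_inj (mulIg t)) /=.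
  apply: eq_bigr => s _; rewrite -map_poly_comp.
  by apply: eq_map_poly => x /=; rewrite galMT.
have [c [q [c0 Fc cA]]] := rational_content F0 FQ.
set L := ideal_prod _ _.
have FN i : frac_ideal_set (ideal_prod (enum {: G}) (gal_ideal^~ I)) F`_i.
  by apply: coef_prod_mem => s k; rewrite coef_map; exact: gal_ideal_mem.
(* The content [c] of [F] lies in N(I), whence c N(J) is contained in N(I) N(J), and so in O. *)
have cN := cA _ (submodule_frac_ideal _) FN.
have pairO : forall s, mul_ideal (gal_ideal s I) (gal_ideal s J) `<=` O.
  by move=> s x; rewrite -gal_mul_ideal IJ => -[y Oy <-]; exact: O_gal.
have sL := submodule_scale c (submodule_frac_ideal L).
have cLO : scale_ideal c L `<=` O.
  move=> _ [x Lx <-]; apply: (ideal_prod_pairing (r := enum {: G}) pairO).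
  exact: mul_idealM.
have cL1 : scale_ideal c L 1.
  apply: contrapT => nc1.
  have [P Pprime cLP] := prime_ideal_exists sL cLO nc1.
  have [sP PO P1 _] := Pprime.
  (* Applying [s] to 1 = sum_k a_k b_k, some s(a_k) s(b_k) must lie outside [P]; take b = s(b_k). *)
  have /choice [b hb] : forall s, exists b, frac_ideal_set (gal_ideal s J) b /\
      exists k, ~ P (b *: map_poly s f)`_k.
    move=> s; apply: contrapT => /forallNP nb; apply: P1.
    rewrite -(rmorph1 s) e1 rmorph_sum big_seq; apply: submodule_sum => // p pr.
    have [Ip Jp] := rIJ _ pr; apply: contrapT => nP; apply: (nb (s p.2)).
    split; first exact: gal_ideal_mem.
    exists (index p r); rewrite coefZ coef_map coef_poly index_mem pr nth_index //=.
    by rewrite mulrC -rmorphM.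
  have [|i] := @prod_coef_notin K G P (enum {: G}) (fun s => b s *: map_poly s f) Pprime
    _ (fun s => (hb s).2).
    move=> s i; rewrite coefZ coef_map mulrC; apply: (pairO s).
    by apply: mul_idealM; [exact: gal_ideal_mem | exact: (hb s).1].
  (* The product polynomial is (prod_s b_s) c q, so each of its coefficients is an integer times an
     element of c N(J), hence in [P]. *)
  rewrite scaler_prod coefZ -/F Fc coefZ coef_map mulrCA mulrA mulrC; apply.
  have [_ _] := sP; apply; first exact: O_int.
  by apply: cLP; exists (\prod_(s <- enum {: G}) b s) => //; apply: prod_mem => s; case: (hb s).
exists c^-1; first by rewrite invr_eq0.
rewrite -[LHS]scale_ideal1 -(mulVf c0) -scale_idealA; congr (scale_ideal _ _).
apply/seteqP; split=> // x Ox; rewrite -[x]mulr1.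
by have [_ _] := sL; apply.
Qed.

Lemma pi_ideal_prod (r : seq G) (J : G -> frac_ideal K) (x : Cl) :
  (forall s, \pi_Cl (J s) = x) -> \pi_Cl (ideal_prod r J) = (x ^+ size r)%g.
Proof.
move=> Jx; elim: r => [|s r IH]; first by rewrite expg0.
rewrite /= expgS -IH -{1}(Jx s); apply/esym; exact: pi_class_mul.
Qed.

Lemma card_gal : galois 1 {:K} -> #|{: G}| = \dim {:K}.
Proof.
move=> galK; have := galois_dim galK; rewrite dimv1 divn1 => ->.
by apply: eq_card => s; rewrite gal_kHom ?sub1v // k1AHom.
Qed.

Lemma fixed_class_exp_eq1 (x y : Cl) :
  galois 1 {:K} -> (x * y = 1)%g -> (forall s, gal_class s x = x) ->
  (x ^+ \dim {:K} = 1)%g.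
Proof.
elim/quotW: x => J; elim/quotW: y => I galK.
rewrite [(_ * _)%g]pi_class_mul => /eqmodP/asboolP[c c0 /= OE] fixJ.
have cIJ : mul_ideal (scale_ideal c I) J = O.
  by rewrite mul_scale_ideal mul_idealC -OE.
(* Rescaling by [c] turns [I] into an exact inverse of [J]. A denominator for it is d y, with y
   nonzero in [J] and d a denominator of [J]: d y is integral, and y already carries c I into O. *)
have cI_ideal : is_frac_ideal (scale_ideal c I).
  have [cI0 cID cIM] := submodule_scale c (submodule_frac_ideal I).
  have [_ _ _ [x Ix x0] _] := frac_idealP I.
  have [_ _ _ [y Jy y0] [d [Od d0] dJ]] := frac_idealP J.
  split=> //.
    by exists (c * x); [exists x | rewrite mulf_neq0].
  exists (d * y); first by split; [exact: dJ | rewrite mulf_neq0].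
  move=> z Iz; rewrite -mulrA; apply: OM => //.
  by rewrite mulrC -cIJ; exact: mul_idealM.
have [e e0 NE] := norm_ideal_principal (I := FracIdeal cI_ideal) galK cIJ.
rewrite -(card_gal galK) cardE -(@pi_ideal_prod _ (gal_ideal^~ J)); last first.
  by move=> s; rewrite -pi_gal_class.
by apply/eqmodP/ideal_equiv_imp_sym/asboolP; exists e.
Qed.

End GaloisAction.

(** * Exponents modulo m, and the conclusion *)

Lemma exp_eq_mod (M : monoidType) (m : nat) (g : M) (i j : nat) :
  (g ^+ m = 1)%g -> (forall x : M, exists! i : 'I_m, x = (g ^+ i)%g) ->
  (g ^+ i = g ^+ j)%g -> (i = j %[mod m])%N.
Proof.
move=> gm1 genU; have m_gt0 : (0 < m)%N.
  by have [k _] := genU 1%g; apply: leq_ltn_trans (ltn_ord k).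
have modE k : (g ^+ k = g ^+ (k %% m))%g.
  by rewrite {1}(divn_eq k m) mulnC expgD expgM gm1 expg1n mul1g.
rewrite modE (modE j) => gij.
have [k [_ kU]] := genU (g ^+ (i %% m))%g.
have ei := kU (Ordinal (ltn_pmod i m_gt0)) erefl.
have ej := kU (Ordinal (ltn_pmod j m_gt0)) gij.
by have /(congr1 val) := etrans (esym ei) ej.
Qed.

(** The hypothesis makes [e] a unit modulo [m]. Writing u n = v phi(m) + 1 by Bezout, e^(u n) is 1
    by assumption and is also e by Euler's theorem. *)
Lemma exp_mod1_coprime_totient (e n m : nat) :
  (0 < n)%N -> coprime n (totient m) -> (e ^ n = 1 %[mod m])%N -> (e = 1 %[mod m])%N.
Proof.
move=> n_gt0 /eqP co en1.
have co_e_m : coprime e m.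
  by rewrite -(coprime_pexpl _ _ n_gt0) -coprime_modl en1 coprime_modl coprime1n.
have [u v uvE _] := egcdnP (totient m) n_gt0.
have expM1 a k : (e ^ a = 1 %[mod m])%N -> (e ^ (k * a) = 1 %[mod m])%N.
  by move=> ea1; rewrite mulnC expnM -modnXm ea1 modnXm exp1n.
rewrite -(expM1 _ u en1) uvE co addn1 expnS -modnMmr.
by rewrite expM1 ?Euler_exp_totient // modnMmr muln1.
Qed.

Theorem theorem1p4 (n m : nat) (n_gt1 : (1 < n)%N) (m_gt1 : (1 < m)%N)
    (co_n_m : coprime n m) (co_n_phi : coprime n (totient m)) :
  ~ exists K : splittingFieldType rat,
      [/\ galois 1 {:K},
          cyclic 'Gal({:K} / 1),
          \dim {:K} = n
        & cyclic_group_of_order (ideal_class_group K) m].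
Proof.
case=> K [galK _ dimK [g gm1 genU]].
have expE i j := @exp_eq_mod _ m g i j gm1 genU.
have fixg (s : gal_of {:K}) : gal_class s g = g.
  have [e [ge _]] := genU (gal_class s g).
  have gek k : gal_class (s ^+ k)%g g = (g ^+ (e ^ k))%g.
    elim: k => [|k IH]; first by rewrite expg0 gal_class1 expn0 expg1.
    by rewrite expgSr gal_classM IH gal_class_exp ge -expgM expnS.
  (* As [n] is the order of the Galois group, s^n = 1, so g^(e^n) = g. *)
  have := gek n; rewrite -{1}dimK -(card_gal galK) -cardsT expg_cardG ?inE //.
  rewrite gal_class1 -{1}[g]expg1 => /expE/esym e1.
  have {}e1 := exp_mod1_coprime_totient (ltnW n_gt1) co_n_phi e1.
  (* Both [e] and 1 are below [m], so the congruence is an equality. *)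
  by rewrite ge; move: e1; rewrite !modn_small // => ->.
have /(fixed_class_exp_eq1 galK)/(_ fixg) : (g * g ^+ m.-1 = 1)%g.
  by rewrite -expgS prednK // ltnW.
(* From g^n = g^0, [m] divides [n]; coprimality then forces m = 1. *)
rewrite dimK -(expg0 g) => /expE/eqP; rewrite mod0n => mn.
by move: co_n_m; rewrite /coprime (gcdn_idPr mn) eqn_leq leqNgt m_gt1.
Qed.
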